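(* Let $\Omega\subset\mathbb{R}^{n+1}$ be a non-cylindrical star-like domain of class $\mathrm{Lip}(1,1/2)$. Then $\Omega$ is a $\mathrm{Lip}(1,1/2)$ domain.
   Context: Points of $\mathbb{R}^{n+1}$ are written $(t,x)$ with $t\in\mathbb{R}$ (time variable) and $x\in\mathbb{R}^n$ (spatial variables); when convenient $x=(x',x_n)$ with $x'\in\mathbb{R}^{n-1}$, $x_n\in\mathbb{R}$. $|\cdot|$ is the absolute value or the Euclidean norm, and $S^{n-1}$ is the unit sphere of $\mathbb{R}^n$. **Non-cylindrical star-like domain of class $\mathrm{Lip}(1,1/2)$.** An open set $\Omega\subset\mathbb{R}^{n+1}$ is so called if $$\Omega=\{(s,r\omega):\ s\in\mathbb{R},\ \omega\in S^{n-1},\ 0\le r<\varphi(s,\omega)\},$$ where $\varphi:\mathbb{R}\times S^{n-1}\to(0,\infty)$ is a function for which there is a constant $M>0$ with $$|\varphi(t_1,\omega_1)-\varphi(t_2,\omega_2)|\le M\bigl(|t_1-t_2|^{1/2}+|\omega_1-\omega_2|\bigr)\quad\text{for all }(t_1,\omega_1),(t_2,\omega_2)\in\mathbb{R}\times S^{n-1},$$ and there are constants $\delta_0,K_0>0$ such that $\delta_0<\varphi(s,\omega)<K_0$ for all $(s,\omega)\in\mathbb{R}\times S^{n-1}$. **$\mathrm{Lip}(1,1/2)$ functions.** For an open set $B\subset\mathbb{R}^{n}$ with points written $(t,x')$, $t\in\mathbb{R}$, $x'\in\mathbb{R}^{n-1}$, a function $\psi:B\to\mathbb{R}$ is of type $\mathrm{Lip}(1,1/2)$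 if there is $M>0$ such that $|\psi(t,x')-\psi(s,y')|\le M(|t-s|^{1/2}+|x'-y'|)$ for all $(t,x'),(s,y')\in B$. **$\mathrm{Lip}(1,1/2)$ domain.** An open connected set $\Omega\subset\mathbb{R}^{n+1}$ with $\partial\Omega=\partial\overline{\Omega}$ is a $\mathrm{Lip}(1,1/2)$ domain if for each $X_0\in\partial\Omega$ there exist: a new coordinate system $(t,x',x_n)$ obtained from the original one by a rotation in the spatial variables $x$ (the time coordinate is unchanged); a cylinder $C=B\times I$ containing $X_0$, where, in the new coordinates, $B$ is an open ball in the space $\mathbb{R}^n$ of the variables $(t,x')$ and $I$ is an open interval in the variable $x_n$; and a function $\psi:B\to\mathbb{R}$ of type $\mathrm{Lip}(1,1/2)$ whose local graph $\Sigma(\psi,B)=\{(t,x',\psi(t,x')):(t,x')\in B\}$ contains $X_0$, such that $$C\cap\partial\Omega=C\cap\Sigma(\psi,B).$$ *)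

(* Defs.v *)
From HB Require Import structures.
From mathcomp Require Import all_boot all_order all_algebra.
From mathcomp Require Import all_classical all_reals all_analysis.

Set Implicit Arguments.
Unset Strict Implicit.
Unset Printing Implicit Defensive.

Import Order.TTheory GRing.Theory Num.Theory.
Import numFieldNormedType.Exports.

Local Open Scope classical_set_scope.
Local Open Scope ring_scope.

(* The space R^(n+1) of points (t, x) is R * 'rV[R]_n, with the product
   topology, which is the usual one.  The library's norm on 'rV[R]_n is the sup
   norm, whence the explicit Euclidean norms below. *)

Section Definitions.
Variable R : realType.

Definition enorm (n : nat) (x : 'rV[R]_n) : R :=
  Num.sqrt (\sum_(i < n) x 0 i ^+ 2).

Definition unit_sphere (n : nat) : set 'rV[R]_n := [set w | enorm w = 1].

Definition eball (n : nat) (c : R * 'rV[R]_n) (rho : R) : set (R * 'rV[R]_n) :=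
  [set p | Num.sqrt ((p.1 - c.1) ^+ 2 + enorm (p.2 - c.2) ^+ 2) < rho].

Definition boundary (T : topologicalType) (A : set T) : set T :=
  closure A `\` interior A.

(* Only the values of f on D matter: a function defined on D alone is
   represented by an arbitrary extension to the whole space. *)
Definition lip_1_half (n : nat) (D : set (R * 'rV[R]_n))
    (f : R * 'rV[R]_n -> R) : Prop :=
  exists M : R, 0 < M /\
    forall p q, D p -> D q ->
      `|f p - f q| <= M * (Num.sqrt `|p.1 - q.1| + enorm (p.2 - q.2)).

Definition noncylindrical_starlike_lip (n : nat)
    (Omega : set (R * 'rV[R]_n)) : Prop :=
  open Omega /\
  exists phi : R * 'rV[R]_n -> R,
    [/\ forall s w, unit_sphere w -> 0 < phi (s, w),
        lip_1_half (setT `*` @unit_sphere n) phi,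
        exists delta0 K0 : R, [/\ 0 < delta0, 0 < K0 &
          forall s w, unit_sphere w -> delta0 < phi (s, w) < K0] &
        Omega = [set p | exists (s r : R) (w : 'rV[R]_n),
          [/\ unit_sphere w, 0 <= r < phi (s, w) & p = (s, r *: w)]]].

Definition rotation (n : nat) (A : 'M[R]_n) : Prop :=
  A *m A^T = 1%:M /\ \det A = 1.

(* The coordinates ((t, x'), x_n) of a point, where (x', x_n) are the
   coordinates of its spatial part after the rotation A, and x_n is the last
   one; the spatial dimension is n = m.+1. *)
Definition new_coords (m : nat) (A : 'M[R]_m.+1) (p : R * 'rV[R]_m.+1) :
    (R * 'rV[R]_m) * R :=
  ((p.1, col' ord_max (p.2 *m A)), (p.2 *m A) 0 ord_max).

Definition graph_on (m : nat) (B : set (R * 'rV[R]_m))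
    (psi : R * 'rV[R]_m -> R) : set ((R * 'rV[R]_m) * R) :=
  [set q | B q.1 /\ q.2 = psi q.1].

Definition lip_domain (m : nat) (Omega : set (R * 'rV[R]_m.+1)) : Prop :=
  [/\ open Omega, connected Omega,
      boundary Omega = boundary (closure Omega) &
      forall X0, boundary Omega X0 ->
        exists (A : 'M[R]_m.+1) (c : R * 'rV[R]_m) (rho a b : R)
               (psi : R * 'rV[R]_m -> R),
          let B := eball c rho in
          let C := new_coords A @^-1` (B `*` `]a, b[) in
          let Sigma := new_coords A @^-1` graph_on B psi in
          [/\ rotation A, C X0, lip_1_half B psi, Sigma X0 &
              C `&` boundary Omega = C `&` Sigma]].

End Definitions.

(* Main.v *)
(* After an orthogonal change of coordinates sending the direction of X0 to the
   last axis, a point (t, u, z) with z > 0 lies on the ray through (u / z, 1),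
   so it is a boundary point iff z = h (t, u / z), where h (t, v) is the radial
   function in the direction of (v, 1) divided by |(v, 1)|.  The function h is
   Lip(1,1/2), and for small u the map z |-> h (t, u / z) is a contraction,
   whatever the Lipschitz constant; its fixed point psi (t, u) is therefore
   Lip(1,1/2). *)

Require Import Defs.
From HB Require Import structures.
From mathcomp Require Import all_boot all_order all_algebra.
From mathcomp Require Import all_classical all_reals all_analysis.
From mathcomp Require Import ring lra.

Set Implicit Arguments.
Unset Strict Implicit.
Unset Printing Implicit Defensive.

Import Order.TTheory GRing.Theory Num.Theory.
Import numFieldNormedType.Exports.

Local Open Scope classical_set_scope.
Local Open Scope ring_scope.

(** * Euclidean inner product and norm on row vectors *)

(** Writing it as a matrix product makes invariance under an orthogonal matrix a matter of
    associativity. *)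
Definition dot (R : realType) (n : nat) (x y : 'rV[R]_n) : R :=
  (x *m y^T) 0 0.

Lemma dotE (R : realType) (n : nat) (x y : 'rV[R]_n) :
  dot x y = \sum_(i < n) x 0 i * y 0 i.
Proof. by rewrite /dot mxE; apply: eq_bigr => i _; rewrite mxE. Qed.

Lemma dotC (R : realType) (n : nat) (x y : 'rV[R]_n) : dot x y = dot y x.
Proof. by rewrite !dotE; apply: eq_bigr => i _; rewrite mulrC. Qed.

Lemma dotDl (R : realType) (n : nat) (x y z : 'rV[R]_n) :
  dot (x + y) z = dot x z + dot y z.
Proof. by rewrite /dot mulmxDl mxE. Qed.

Lemma dotZl (R : realType) (n : nat) (k : R) (x y : 'rV[R]_n) :
  dot (k *: x) y = k * dot x y.
Proof. by rewrite /dot -scalemxAl mxE. Qed.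

Lemma dotNl (R : realType) (n : nat) (x y : 'rV[R]_n) :
  dot (- x) y = - dot x y.
Proof. by rewrite /dot mulNmx mxE. Qed.

Lemma dotDr (R : realType) (n : nat) (x y z : 'rV[R]_n) :
  dot z (x + y) = dot z x + dot z y.
Proof. by rewrite dotC dotDl !(dotC z). Qed.

Lemma dotZr (R : realType) (n : nat) (k : R) (x y : 'rV[R]_n) :
  dot x (k *: y) = k * dot x y.
Proof. by rewrite dotC dotZl dotC. Qed.

Lemma dotNr (R : realType) (n : nat) (x y : 'rV[R]_n) :
  dot x (- y) = - dot x y.
Proof. by rewrite dotC dotNl dotC. Qed.

Lemma dot_orthogonal (R : realType) (n : nat) (A : 'M[R]_n) (x y : 'rV[R]_n) :
  A *m A^T = 1%:M -> dot (x *m A) (y *m A) = dot x y.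
Proof.
by move=> AAT; rewrite /dot trmx_mul mulmxA -(mulmxA x) AAT mulmx1.
Qed.

Lemma dotxx_ge0 (R : realType) (n : nat) (x : 'rV[R]_n) : 0 <= dot x x.
Proof. by rewrite dotE; apply: sumr_ge0 => i _; rewrite -expr2 sqr_ge0. Qed.

Lemma dotxx_eq0 (R : realType) (n : nat) (x : 'rV[R]_n) :
  (dot x x == 0) = (x == 0).
Proof.
apply/eqP/eqP => [|->]; last by rewrite dotE big1 // => i _; rewrite mxE mul0r.
rewrite dotE => /eqP; rewrite psumr_eq0; last first.
  by move=> i _; rewrite -expr2 sqr_ge0.
move=> /allP x0; apply/rowP => i; rewrite mxE; apply/eqP.
by have := x0 i (mem_index_enum _); rewrite /= -expr2 sqrf_eq0.
Qed.

Lemma enormE (R : realType) (n : nat) (x : 'rV[R]_n) :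
  enorm x = Num.sqrt (dot x x).
Proof. by rewrite dotE. Qed.

Lemma enorm_ge0 (R : realType) (n : nat) (x : 'rV[R]_n) : 0 <= enorm x.
Proof. exact: sqrtr_ge0. Qed.

Lemma sqr_enorm (R : realType) (n : nat) (x : 'rV[R]_n) :
  enorm x ^+ 2 = dot x x.
Proof. by rewrite enormE sqr_sqrtr // dotxx_ge0. Qed.

Lemma enorm_eq0 (R : realType) (n : nat) (x : 'rV[R]_n) :
  (enorm x == 0) = (x == 0).
Proof. by rewrite -sqrf_eq0 sqr_enorm dotxx_eq0. Qed.

Lemma enorm0 (R : realType) (n : nat) : enorm (0 : 'rV[R]_n) = 0.
Proof. by apply/eqP; rewrite enorm_eq0. Qed.

Lemma enorm_gt0 (R : realType) (n : nat) (x : 'rV[R]_n) :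
  (0 < enorm x) = (x != 0).
Proof. by rewrite lt0r enorm_eq0 enorm_ge0 andbT. Qed.

Lemma enormZ (R : realType) (n : nat) (k : R) (x : 'rV[R]_n) :
  enorm (k *: x) = `|k| * enorm x.
Proof.
by rewrite enormE dotZl dotZr mulrA -expr2 sqrtrM ?sqr_ge0// sqrtr_sqr -enormE.
Qed.

Lemma enormN (R : realType) (n : nat) (x : 'rV[R]_n) : enorm (- x) = enorm x.
Proof. by rewrite -scaleN1r enormZ normrN1 mul1r. Qed.

Lemma enorm_distC (R : realType) (n : nat) (x y : 'rV[R]_n) :
  enorm (x - y) = enorm (y - x).
Proof. by rewrite -enormN opprB. Qed.

Lemma enorm_orthogonal (R : realType) (n : nat) (A : 'M[R]_n) (x : 'rV[R]_n) :
  A *m A^T = 1%:M -> enorm (x *m A) = enorm x.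
Proof. by move=> AAT; rewrite !enormE dot_orthogonal. Qed.

(** For [y != 0] the squared norm of [dot y y *: x - dot x y *: y] is [c * (a * c - b ^+ 2)], where
    [a], [b], [c] stand for [dot x x], [dot x y], [dot y y]; as [c > 0], the second factor is
    nonnegative. *)
Lemma cauchy_schwarz (R : realType) (n : nat) (x y : 'rV[R]_n) :
  dot x y <= enorm x * enorm y.
Proof.
have [->|y0] := eqVneq y 0.
  by rewrite enorm0 mulr0 -(scale0r 0) dotZr mul0r.
apply: le_trans (ler_norm _) _; rewrite -ler_sqr ?nnegrE ?mulr_ge0 ?enorm_ge0//.
rewrite real_normK ?num_real// exprMn !sqr_enorm.
have y2 : 0 < dot y y by rewrite lt0r dotxx_eq0 y0 dotxx_ge0.
have := dotxx_ge0 (dot y y *: x - dot x y *: y).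
rewrite !(dotDl, dotDr, dotNl, dotNr, dotZl, dotZr) (dotC y x).
set a := dot x x; set b := dot x y; set c := dot y y in y2 *.
set d := (X in 0 <= X).
have -> : d = c * (a * c - b ^+ 2) by rewrite /d; ring.
by rewrite pmulr_rge0// subr_ge0.
Qed.

Lemma ler_enormD (R : realType) (n : nat) (x y : 'rV[R]_n) :
  enorm (x + y) <= enorm x + enorm y.
Proof.
rewrite -ler_sqr ?nnegrE ?addr_ge0 ?enorm_ge0// sqrrD !sqr_enorm.
rewrite !(dotDl, dotDr) (dotC y x).
by have := cauchy_schwarz x y; lra.
Qed.

Lemma ler_dist_enorm (R : realType) (n : nat) (x y : 'rV[R]_n) :
  `|enorm x - enorm y| <= enorm (x - y).
Proof.
have := ler_enormD (x - y) y; have := ler_enormD (y - x) x.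
by rewrite !subrK ler_norml (enorm_distC y x); lra.
Qed.

(** * Unit directions and reflections *)

(** At [x = 0] this is the zero vector, which is off the sphere; hence the guards [x != 0] below. *)
Local Notation direction x := ((enorm x)^-1 *: x).

Lemma unit_sphere_normalize (R : realType) (n : nat) (x : 'rV[R]_n) :
  x != 0 -> unit_sphere (direction x).
Proof.
move=> x0; rewrite /unit_sphere /= enormZ ger0_norm ?invr_ge0 ?enorm_ge0//.
by rewrite mulVf// enorm_eq0.
Qed.

(** The difference is [(x - y) / |x|] plus [(1 / |x| - 1 / |y|) y], and each term has norm at most
    [|x - y| / |x|]. Only [enorm x] is in the denominator, so [y] may vary around a fixed [x]. *)
Lemma enorm_normalizeB (R : realType) (n : nat) (x y : 'rV[R]_n) :
  x != 0 -> y != 0 ->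
  enorm (direction x - direction y) <= 2 * enorm (x - y) / enorm x.
Proof.
move=> x0 y0.
have xp : 0 < enorm x by rewrite enorm_gt0.
have yp : 0 < enorm y by rewrite enorm_gt0.
have -> : (enorm x)^-1 *: x - (enorm y)^-1 *: y =
    (enorm x)^-1 *: (x - y) + ((enorm x)^-1 - (enorm y)^-1) *: y.
  by rewrite scalerBr scalerBl addrA subrK.
apply: le_trans (ler_enormD _ _) _; rewrite !enormZ.
rewrite gtr0_norm ?invr_gt0//.
have -> : `|(enorm x)^-1 - (enorm y)^-1| * enorm y =
    `|enorm x - enorm y| / enorm x.
  rewrite -{2}(gtr0_norm yp) -normrM distrC -{3}(gtr0_norm xp).
  rewrite -normfV -normrM; congr `|_|.
  by field; rewrite !gt_eqF.
rewrite mulrC -mulrDl ler_wpM2r ?invr_ge0 ?enorm_ge0//.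
by rewrite mulr2n mulrDl mul1r lerD2l ler_dist_enorm.
Qed.

(** For [w != e], [H] is the reflection in the hyperplane orthogonal to [v = w - e]. As [w] and [e]
    have the same norm, [dot v v = 2 * dot w v], so [w] is moved by exactly [- v]. *)
Lemma householder (R : realType) (n : nat) (w e : 'rV[R]_n) :
  unit_sphere w -> unit_sphere e ->
  exists H : 'M[R]_n, H *m H^T = 1%:M /\ w *m H = e.
Proof.
move=> w1 e1; have [->|we] := eqVneq w e.
  by exists 1%:M; rewrite trmx1 !mulmx1.
have sc (x y : 'rV[R]_n) : x *m y^T = (dot x y)%:M by rewrite [LHS]mx11_scalar.
pose v := w - e; have v0 : v != 0 by rewrite subr_eq0.
have vv : dot v v != 0 by rewrite dotxx_eq0.
have vve : dot v v = 2 * dot w v.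
  rewrite /v !(dotDl, dotDr, dotNl, dotNr) (dotC e w) -!sqr_enorm w1 e1; ring.
have wv : w - v = e by rewrite opprB addrC subrK.
clearbody v; exists (1%:M - (2 / dot v v) *: (v^T *m v)); split.
  rewrite linearB /= trmx1 [(_ *: _)^T]linearZ_LR /= trmx_mul trmxK.
  rewrite mulmxBl mulmxBr !mul1mx mulmxBr mulmx1 -!scalemxAl -!scalemxAr.
  rewrite mulmxA -(mulmxA v^T) sc mul_mx_scalar -scalemxAl !scalerA.
  have -> : 2 / dot v v * (2 / dot v v * dot v v) = 2 / dot v v + 2 / dot v v.
    by field.
  by rewrite scalerDl opprB addrK subrK.
rewrite mulmxBr mulmx1 -scalemxAr mulmxA sc mul_scalar_mx scalerA.
have -> : 2 / dot v v * dot w v = 1 by rewrite mulrAC -vve divff.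
by rewrite scale1r.
Qed.

(** * Splitting off the last coordinate *)

(** Inverse of the splitting in [new_coords], which takes [col' ord_max] and the entry at
    [ord_max]. *)
Definition row_snoc (R : realType) (m : nat) (u : 'rV[R]_m) (z : R) :
    'rV[R]_m.+1 :=
  \row_j if unlift ord_max j is Some i then u 0 i else z.

Lemma row_snoc_lift (R : realType) (m : nat) (u : 'rV[R]_m) (z : R) i :
  row_snoc u z 0 (lift ord_max i) = u 0 i.
Proof. by rewrite mxE liftK. Qed.

Lemma row_snoc_max (R : realType) (m : nat) (u : 'rV[R]_m) (z : R) :
  row_snoc u z 0 ord_max = z.
Proof. by rewrite mxE unlift_none. Qed.

Lemma row_snocP (R : realType) (m : nat) (x : 'rV[R]_m.+1) :
  row_snoc (col' ord_max x) (x 0 ord_max) = x.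
Proof.
apply/rowP => j; case: (unliftP ord_max j) => [i|] ->.
  by rewrite row_snoc_lift mxE.
by rewrite row_snoc_max.
Qed.

Lemma row_snocZ (R : realType) (m : nat) (k : R) (u : 'rV[R]_m) (z : R) :
  k *: row_snoc u z = row_snoc (k *: u) (k * z).
Proof.
by apply/rowP => j; rewrite !mxE; case: unliftP => [i|] _; rewrite ?mxE.
Qed.

Lemma row_snocB (R : realType) (m : nat) (u v : 'rV[R]_m) (z y : R) :
  row_snoc u z - row_snoc v y = row_snoc (u - v) (z - y).
Proof.
by apply/rowP => j; rewrite !mxE; case: unliftP => [i|] _; rewrite ?mxE.
Qed.

Lemma sqr_enorm_row_snoc (R : realType) (m : nat) (u : 'rV[R]_m) (z : R) :
  enorm (row_snoc u z) ^+ 2 = enorm u ^+ 2 + z ^+ 2.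
Proof.
rewrite !sqr_enorm !dotE (bigD1_ord ord_max)//= row_snoc_max addrC expr2.
by congr (_ + _); apply: eq_bigr => i _; rewrite row_snoc_lift.
Qed.

Lemma enorm_row_snoc0 (R : realType) (m : nat) (u : 'rV[R]_m) :
  enorm (row_snoc u 0) = enorm u.
Proof.
apply/eqP; rewrite -(@eqrXn2 _ 2)// ?enorm_ge0//.
by rewrite sqr_enorm_row_snoc expr0n addr0.
Qed.

Lemma enorm_row_snoc1_ge1 (R : realType) (m : nat) (u : 'rV[R]_m) :
  1 <= enorm (row_snoc u 1).
Proof.
rewrite -ler_sqr ?nnegrE ?enorm_ge0// sqr_enorm_row_snoc expr1n.
by rewrite lerDr sqr_ge0.
Qed.

Lemma row_snoc1_neq0 (R : realType) (m : nat) (u : 'rV[R]_m) :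
  row_snoc u 1 != 0.
Proof. by rewrite -enorm_gt0 (lt_le_trans ltr01)// enorm_row_snoc1_ge1. Qed.

(** * The radial function in the chart at height one *)

(* On the ray through the point at height [1] with horizontal part [u], the
   height of the point at distance [phi] from the origin. *)
Definition ray_height (R : realType) (m : nat) (phi : R * 'rV[R]_m.+1 -> R)
    (p : R * 'rV[R]_m) : R :=
  phi (p.1, direction (row_snoc p.2 1)) /
  enorm (row_snoc p.2 1).

(** With both norms [X] and [Y] at least 1, [a / X - b / Y = (a - b) / X + b / (X * Y) * (Y - X)].
    The first term costs at most [M * (tau + 2 * d)], since normalization at most doubles distances
    here, and the second at most [K * d]. *)
Lemma ray_height_lip (R : realType) (m : nat) (phi : R * 'rV[R]_m.+1 -> R)
    (M K : R) :
  0 < M ->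
  (forall p q, unit_sphere p.2 -> unit_sphere q.2 ->
    `|phi p - phi q| <= M * (Num.sqrt `|p.1 - q.1| + enorm (p.2 - q.2))) ->
  (forall s w, unit_sphere w -> 0 < phi (s, w) < K) ->
  forall p q, `|ray_height phi p - ray_height phi q| <=
    (2 * M + K) * (Num.sqrt `|p.1 - q.1| + enorm (p.2 - q.2)).
Proof.
move=> M0 lip bnd [t u] [s v] /=; rewrite /ray_height /=.
set x := row_snoc u 1; set y := row_snoc v 1.
have x0 : x != 0 := row_snoc1_neq0 u; have y0 : y != 0 := row_snoc1_neq0 v.
have x1 : 1 <= enorm x := enorm_row_snoc1_ge1 u.
have y1 : 1 <= enorm y := enorm_row_snoc1_ge1 v.
have xy : enorm (x - y) = enorm (u - v).
  by rewrite /x /y row_snocB subrr enorm_row_snoc0.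
have := lip (t, (enorm x)^-1 *: x) (s, (enorm y)^-1 *: y)
  (unit_sphere_normalize x0) (unit_sphere_normalize y0).
have /andP[] := bnd s _ (unit_sphere_normalize y0).
have := enorm_normalizeB x0 y0; have := ler_dist_enorm x y.
rewrite /= xy; set d := enorm (u - v); have d0 : 0 <= d := enorm_ge0 _.
set tau := Num.sqrt _; have tau0 : 0 <= tau := sqrtr_ge0 _.
set b := phi _; set a := phi _; set e := enorm (_ - _).
move: (enorm x) (enorm y) x1 y1 => X Y X1 Y1 XY eX b0 bK ab.
have X0 : 0 < X by lra.
have Y0 : 0 < Y by lra.
have -> : a / X - b / Y = (a - b) / X + b / (X * Y) * (Y - X).
  by field; rewrite !gt_eqF.
have e2 : e <= 2 * d.
  by apply: le_trans eX _; rewrite ler_pdivrMr// ler_peMr// mulr_ge0.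
apply: le_trans (ler_normD _ _) _.
rewrite (normrM (a - b)) (normrM (b / _)) distrC normfV.
rewrite (gtr0_norm X0) (distrC Y).
have -> : `|b / (X * Y)| = b / (X * Y).
  by rewrite gtr0_norm// divr_gt0// mulr_gt0.
have h1 : `|b - a| / X <= M * (tau + 2 * d).
  rewrite ler_pdivrMr//; apply: le_trans (_ : M * (tau + 2 * d) <= _).
    by rewrite distrC (le_trans ab)// ler_pM2l// lerD2l.
  by rewrite ler_peMr// mulr_ge0 ?addr_ge0 ?mulr_ge0 ?(ltW M0).
have h2 : b / (X * Y) * `|X - Y| <= K * d.
  apply: ler_pM => //; first by rewrite divr_ge0 ?mulr_ge0 ?ltW.
  rewrite ler_pdivrMr ?mulr_gt0// (le_trans (ltW bK))// ler_peMr//; first lra.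
  by rewrite mulr_ege1.
have K0 : 0 <= K * tau by rewrite mulr_ge0//; lra.
have M0t : 0 <= M * tau by rewrite mulr_ge0// ltW.
by nra.
Qed.

(** * The fixed-point equation and its Lipschitz solution *)

(** Splitting off [(z^-1 - y^-1) *: v] puts the bound [eta] on [v] in front of [|z - y|]: a small
    [eta] makes the dependence on the height as weak as desired. *)
Lemma enorm_scaleV_dist (R : realType) (m : nat) (c eta z y : R)
    (u v : 'rV[R]_m) :
  0 < c -> c <= z -> c <= y -> enorm v <= eta ->
  enorm (z^-1 *: u - y^-1 *: v) <=
    enorm (u - v) / c + eta / c ^+ 2 * `|z - y|.
Proof.
move=> c0 cz cy veta.
have z0 : 0 < z by lra.
have y0 : 0 < y by lra.
have -> : z^-1 *: u - y^-1 *: v = z^-1 *: (u - v) + (z^-1 - y^-1) *: v.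
  by rewrite scalerBr scalerBl addrA subrK.
apply: le_trans (ler_enormD _ _) _; rewrite !enormZ; apply: lerD.
  by rewrite gtr0_norm ?invr_gt0// mulrC ler_wpM2l ?enorm_ge0// lef_pV2.
have -> : z^-1 - y^-1 = (y - z) / (z * y) by field; rewrite !gt_eqF.
rewrite normrM normfV (distrC y) (gtr0_norm (mulr_gt0 z0 y0)).
rewrite mulrC mulrA mulrAC.
rewrite ler_wpM2r//; apply: ler_pM => //; first exact: enorm_ge0.
  by rewrite invr_ge0 mulr_ge0 ?ltW.
by rewrite lef_pV2 ?posrE ?exprn_gt0 ?mulr_gt0// expr2 ler_pM// ltW.
Qed.

Lemma dist_maxr (R : realType) (z y c : R) :
  `|Num.max z c - Num.max y c| <= `|z - y|.
Proof.
by case: (lerP z c); case: (lerP y c) => ? ?; rewrite ler_norml;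
  have := ler_norm (z - y); have := ler_norm (y - z); rewrite (distrC y);
  have := normr_ge0 (z - y); lra.
Qed.

Lemma lipschitz_continuous (R : realType) (f : R -> R) (k : R) :
  0 < k -> (forall z y, `|f z - f y| <= k * `|z - y|) -> continuous f.
Proof.
move=> k0 lip z; apply/cvgrPdist_le => e e0; near=> y.
apply: le_trans (lip _ _) _; rewrite mulrC -ler_pdivlMr//.
near: y; apply: cvgr_dist_le; first exact: cvg_id.
by rewrite divr_gt0.
Unshelve. all: by end_near. Qed.

(* For small [u] the map [z |-> h (t, u / z)] is a 1/2-contraction of [[c, K]];
   [psi (t, u)] is its fixed point. *)
Lemma implicit_lip (R : realType) (m : nat) (h : R * 'rV[R]_m -> R)
    (L c K eta : R) :
  0 < L -> 0 < c < K -> 0 < eta <= c -> 2 * L * eta <= c ^+ 2 ->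
  (forall p q, `|h p - h q| <=
    L * (Num.sqrt `|p.1 - q.1| + enorm (p.2 - q.2))) ->
  (forall p, enorm p.2 <= 1 -> c < h p < K) ->
  let B := [set p : R * 'rV[R]_m | enorm p.2 < eta] in
  exists psi : R * 'rV[R]_m -> R, lip_1_half B psi /\
    forall p z, B p -> c <= z -> z = h (p.1, z^-1 *: p.2) <-> z = psi p.
Proof.
move=> L0 /andP[c0 cK] /andP[eta0 etac] small lip bnd B.
(* One estimate with distinct [p] and [q] gives both the contraction, when [p = q], and the
   dependence on the point. *)
have contr p q z y : B q -> c <= z -> c <= y ->
    `|h (p.1, z^-1 *: p.2) - h (q.1, y^-1 *: q.2)| <=
    L * (1 + c^-1) * (Num.sqrt `|p.1 - q.1| + enorm (p.2 - q.2))
    + `|z - y| / 2.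
  move=> Bq cz cy; apply: le_trans (lip _ _) _; rewrite /=.
  have := enorm_scaleV_dist p.2 c0 cz cy (ltW Bq).
  set e := enorm _; set d := enorm _; have d0 : 0 <= d := enorm_ge0 _.
  set tau := Num.sqrt _; have tau0 : 0 <= tau := sqrtr_ge0 _ => ed.
  (* The smallness of [eta] enters here: the coefficient of [|z - y|] is at most 1/2, however large
     [L] is. *)
  have Letac : L * (eta / c ^+ 2) <= 2^-1.
    by rewrite mulrA ler_pdivrMr ?exprn_gt0//; lra.
  have c'0 : 0 < c^-1 by rewrite invr_gt0.
  have : L * (eta / c ^+ 2) * `|z - y| <= 2^-1 * `|z - y| by rewrite ler_wpM2r.
  have : L * e <= L * (d / c + eta / c ^+ 2 * `|z - y|) by rewrite ler_pM2l.
  have : 0 <= L * d by rewrite mulr_ge0// ltW.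
  have : 0 <= L * (c^-1 * tau) by rewrite !mulr_ge0// ltW.
  by move: (eta / c ^+ 2) (`|z - y|) (c^-1) => ? ? ?; lra.
(* Absorbing [|z - y| / 2] on the left doubles the constant. With [p = q] this is uniqueness of the
   fixed point. *)
have dist p q z y : B p -> B q -> c <= z -> c <= y ->
    z = h (p.1, z^-1 *: p.2) -> y = h (q.1, y^-1 *: q.2) ->
    `|z - y| <=
    2 * (L * (1 + c^-1)) * (Num.sqrt `|p.1 - q.1| + enorm (p.2 - q.2)).
  move=> Bp Bq cz cy zE yE; have := contr p q z y Bq cz cy.
  by rewrite -zE -yE; lra.
(* The condition [B p] stands under the existential so that [choice] yields a total function,
   arbitrary outside [B]. *)
have fixpt p : exists z, B p -> c <= z /\ z = h (p.1, z^-1 *: p.2).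
  case: (pselect (B p)) => [Bp|nBp]; last by exists 0.
  (* A fixed point is found as a zero of [f] by the intermediate value theorem. Truncating the
     height at [c] makes [f] Lipschitz on the whole line and leaves [[c, K]] unaffected. *)
  pose f z := z - h (p.1, (Num.max z c)^-1 *: p.2).
  have fc : continuous f.
    apply: (@lipschitz_continuous _ _ 2) => // z y.
    have := contr p p (Num.max z c) (Num.max y c) Bp.
    rewrite !le_max !lexx !orbT => /(_ isT isT).
    rewrite !subrr normr0 sqrtr0 enorm0 addr0 mulr0 add0r => hzy.
    have -> : f z - f y = (z - y) - (h (p.1, (Num.max z c)^-1 *: p.2)
      - h (p.1, (Num.max y c)^-1 *: p.2)) by rewrite /f; ring.
    apply: le_trans (ler_normB _ _) _.
    by have := dist_maxr z y c; have := normr_ge0 (z - y); lra.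
  have ubnd z : enorm ((Num.max z c)^-1 *: p.2) <= 1.
    have mc : c <= Num.max z c by rewrite le_max lexx orbT.
    have m0 : 0 < Num.max z c by lra.
    rewrite enormZ gtr0_norm ?invr_gt0// mulrC ler_pdivrMr// mul1r.
    by apply: le_trans (ltW Bp) _; lra.
  have [||z] := @IVT _ f c K 0 (ltW cK).
  - exact: continuous_subspaceT.
  (* The bounds [c < h < K] give [f c < 0 < f K]. *)
  - have /andP[hc _] := bnd (p.1, _) (ubnd c).
    have /andP[_ hK] := bnd (p.1, _) (ubnd K).
    by rewrite ge_min le_max /f !subr_le0 !subr_ge0 (ltW hc) (ltW hK) orbT.
  rewrite in_itv /= => /andP[cz zK] /eqP; rewrite subr_eq0 max_l// => /eqP zE.
  by exists z.
have [psi psiP] := choice fixpt; exists psi; split.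
  exists (2 * (L * (1 + c^-1))); split.
    by rewrite !mulr_gt0// addr_gt0// invr_gt0.
  move=> p q Bp Bq; have [cp pE] := psiP p Bp; have [cq qE] := psiP q Bq.
  exact: dist.
move=> p z Bp cz; have [cp pE] := psiP p Bp; split=> [zE|->//].
have := dist p p z _ Bp Bp cz cp zE pE.
rewrite !subrr normr0 sqrtr0 enorm0 addr0 mulr0 normr_le0 subr_eq0.
by move/eqP.
Qed.

(** * Polar description of the domain: closure, boundary, connectedness *)

Lemma direction_scale (R : realType) (n : nat) (k : R) (x : 'rV[R]_n) :
  0 < k -> direction (k *: x) = direction x.
Proof.
move=> k0; rewrite enormZ gtr0_norm// invfM scalerA.
by rewrite mulrAC mulVf ?gt_eqF// mul1r.
Qed.

(** The topology on ['rV[R]_n] is that of the sup norm, so continuity is reduced to that of the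
    coordinates. *)
Lemma enorm_continuous (R : realType) (n : nat) :
  continuous (@enorm R n).
Proof.
move=> x; apply: continuous_comp; last exact: sqrt_continuous.
have c i : {for x, continuous (fun y : 'rV[R]_n => y 0 i ^+ 2)}.
  apply: (@continuous_comp _ _ _ (fun y : 'rV[R]_n => y 0 i) (fun t => t ^+ 2)).
    exact: coord_continuous.
  exact: exprn_continuous.
by apply: (@cvg_big _ _ +%R 0 xpredT (@add_continuous R^o)) => [|i _];
  [exact: nbhs_filter|exact: c].
Qed.

(* The two sets below are [r < phi] and [r = phi] in polar coordinates
   [(s, r *: w)]. *)
Definition radial_hypograph (R : realType) (n : nat)
    (phi : R * 'rV[R]_n -> R) : set (R * 'rV[R]_n) :=
  [set p | p.2 != 0 -> enorm p.2 < phi (p.1, direction p.2)].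

Definition radial_graph (R : realType) (n : nat)
    (phi : R * 'rV[R]_n -> R) : set (R * 'rV[R]_n) :=
  [set p | p.2 != 0 /\ enorm p.2 = phi (p.1, direction p.2)].

(** The axis to which the direction of a boundary point is sent; it also witnesses that the unit
    sphere is nonempty. *)
Definition last_vector (R : realType) (m : nat) : 'rV[R]_m.+1 := row_snoc 0 1.

Lemma unit_sphere_last_vector (R : realType) (m : nat) :
  unit_sphere (last_vector R m).
Proof.
rewrite /unit_sphere /=; apply/eqP.
rewrite -(@eqrXn2 _ 2)// ?enorm_ge0//.
by rewrite sqr_enorm_row_snoc enorm0 expr0n add0r.
Qed.

Lemma radial_hypographE (R : realType) (m : nat) (phi : R * 'rV[R]_m.+1 -> R) :
  (forall s w, unit_sphere w -> 0 < phi (s, w)) ->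
  [set p | exists (s r : R) (w : 'rV[R]_m.+1),
     [/\ unit_sphere w, 0 <= r < phi (s, w) & p = (s, r *: w)]] =
  radial_hypograph phi.
Proof.
move=> phi0; apply/seteqP; split=> [_ [s [r [w [w1 /andP[r0 rphi] ->]]]]|[s x]].
  rewrite /radial_hypograph /= scaler_eq0 negb_or => /andP[rn0 _].
  have {}r0 : 0 < r by rewrite lt0r rn0.
  by rewrite direction_scale// enormZ w1 invr1 scale1r mulr1 gtr0_norm.
rewrite /radial_hypograph /= => xphi; have [->|x0] := eqVneq x 0.
  (* On the axis the radius is 0 and any unit vector serves, because [phi] is positive. *)
  exists s, 0, (last_vector R m).
  have e1 := unit_sphere_last_vector R m.
  by split; rewrite ?lexx ?phi0// scale0r.
exists s, (enorm x), (direction x); split; first exact: unit_sphere_normalize.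
  by rewrite enorm_ge0 xphi.
by rewrite scalerA divff ?scale1r// enorm_eq0.
Qed.

Lemma scale_snd_continuous (R : realType) (n : nat) (p : R * 'rV[R]_n) :
  continuous (fun k : R => (p.1, k *: p.2)).
Proof.
move=> k; exact: (@cvg_pair _ _ _ (nbhs k) (nbhs p.1) (nbhs (k *: p.2))
  _ _ _ _ _ (cvg_cst p.1) (@scalel_continuous _ _ p.2 k)).
Qed.

(** Scaling by [k > 0] at fixed time keeps the direction, hence the value of [phi]. Approach with
    [k < 1] serves the closure, with [k > 1] the interior. *)
Lemma cvg_scale1 (R : realType) (n : nat) (p : R * 'rV[R]_n) :
  (p.1, k *: p.2) @[k --> (1 : R)] --> p.
Proof.
have := @scale_snd_continuous _ _ p 1.
by rewrite /continuous_at scale1r -surjective_pairing.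
Qed.

Lemma closure_radial_hypograph (R : realType) (n : nat)
    (phi : R * 'rV[R]_n -> R) :
  lip_1_half (setT `*` @unit_sphere R n) phi ->
  closure (radial_hypograph phi) =
  [set p | p.2 != 0 -> enorm p.2 <= phi (p.1, direction p.2)].
Proof.
move=> [M [M0 lip]]; apply/seteqP; split=> [p clp p0|p phip].
  rewrite leNgt; apply/negP => phip.
  (* For [q.2 != 0], the Lipschitz bound and [enorm_normalizeB] make [f q] a lower bound for
     [enorm q.2 - phi (q.1, direction q.2)]. It is continuous at [p] and positive there, so a
     neighbourhood of [p] misses the hypograph. *)
  pose f (q : R * 'rV[R]_n) := enorm q.2 -
    (phi (p.1, direction p.2) + M * (Num.sqrt `|p.1 - q.1| +
      2 * enorm (p.2 - q.2) / enorm p.2)).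
  have fp : 0 < f p.
    rewrite /f !subrr normr0 sqrtr0 enorm0 mulr0 mul0r addr0 mulr0 addr0.
    by rewrite subr_gt0.
  have c2 : {for p, continuous (fun q : R * 'rV[R]_n => enorm q.2)}.
    by apply: continuous_comp; [exact: cvg_snd | exact: enorm_continuous].
  have c3 : {for p, continuous (fun q : R * 'rV[R]_n => enorm (p.2 - q.2))}.
    have h : {for p, continuous (fun q : R * 'rV[R]_n => p.2 - q.2)}.
      by apply: cvgB; [exact: cvg_cst | exact: cvg_snd].
    exact: (continuous_comp h (@enorm_continuous _ _ _)).
  have c1 : {for p, continuous (fun q : R * 'rV[R]_n => Num.sqrt `|p.1 - q.1|)}.
    have h : {for p, continuous (fun q : R * 'rV[R]_n => `|p.1 - q.1|)}.
      by apply: cvg_norm; apply: cvgB; [exact: cvg_cst | exact: cvg_fst].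
    exact: (continuous_comp h (@sqrt_continuous _ _)).
  have cf : f q @[q --> p] --> f p.
    apply: cvgB; first exact: c2.
    apply: cvgD; first exact: cvg_cst.
    apply: cvgM; first exact: cvg_cst.
    apply: cvgD; first exact: c1.
    apply: cvgM; last exact: cvg_cst.
    by apply: cvgM; first exact: cvg_cst.
  have near_p : nbhs p [set q | 0 < f q /\ 0 < enorm q.2].
    apply: filterI; first by apply: cvgr_gt cf _ fp.
    by apply: cvgr_gt c2 _ _; rewrite enorm_gt0.
  have [q [qphi [fq]]] := clp _ near_p; rewrite enorm_gt0 => q0.
  have := lip (q.1, direction q.2) (p.1, direction p.2)
    (conj I (unit_sphere_normalize q0)) (conj I (unit_sphere_normalize p0)).
  have := enorm_normalizeB p0 q0; have := qphi q0.
  move: fq; rewrite /f /= (enorm_distC (direction q.2)) (distrC q.1).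
  set e := enorm (p.2 - q.2); set d := enorm (_ - _).
  set tau := Num.sqrt _ => fq qlt de /(le_trans (ler_norm _)).
  have : M * (tau + d) <= M * (tau + 2 * e / enorm p.2).
    by rewrite ler_pM2l// lerD2l.
  lra.
have [p0|p0] := eqVneq p.2 0.
  by apply: subset_closure; rewrite /radial_hypograph /= p0 eqxx.
(* Off the axis, shrinking [p] slightly along its ray makes the inequality strict. *)
move=> U /(cvg_at_left_filter (@cvg_scale1 _ _ p)) pU.
have : \forall k \near (1 : R)^'-,
    [/\ U (p.1, k *: p.2), 0 < k & k < 1].
  near=> k; split; near: k; first exact: pU.
    by apply: nbhs_left_gt.
  exact: nbhs_left_lt.
move=> /filter_ex [k [Uk k0 k1]]; exists (p.1, k *: p.2); split=> // _ /=.
rewrite direction_scale// enormZ gtr0_norm// (lt_le_trans _ (phip p0))//.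
by rewrite gtr_pMl// enorm_gt0.
Unshelve. all: by end_near. Qed.

(** A slight dilation of an interior point along its ray still satisfies the weak inequality, so the
    point itself satisfies the strict one. *)
Lemma interior_closure_radial_hypograph (R : realType) (n : nat)
    (phi : R * 'rV[R]_n -> R) :
  interior [set p | p.2 != 0 -> enorm p.2 <= phi (p.1, direction p.2)] `<=`
  radial_hypograph phi.
Proof.
move=> p /(cvg_at_right_filter (@cvg_scale1 _ _ p)) pU p0.
have : \forall k \near (1 : R)^'+, (k *: p.2 != 0 ->
    enorm (k *: p.2) <= phi (p.1, direction (k *: p.2))) /\ 1 < k.
  near=> k; split; near: k; first exact: pU.
  exact: nbhs_right_gt.
move=> /filter_ex [k [+ k1]]; have k0 : 0 < k by apply: lt_trans k1.
rewrite scaler_eq0 gt_eqF// p0 => /(_ isT).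
rewrite direction_scale// enormZ gtr0_norm//; apply: lt_le_trans.
by rewrite ltr_pMl// enorm_gt0.
Unshelve. all: by end_near. Qed.

(** The open hypograph is the interior of its closure, so both boundaries are the weak inequality
    minus the strict one. *)
Lemma boundary_radial_hypograph (R : realType) (n : nat)
    (phi : R * 'rV[R]_n -> R) :
  lip_1_half (setT `*` @unit_sphere R n) phi -> open (radial_hypograph phi) ->
  boundary (radial_hypograph phi) = radial_graph phi /\
  boundary (closure (radial_hypograph phi)) = radial_graph phi.
Proof.
move=> lip op; rewrite /boundary.
rewrite -[closure (closure _)](closure_id _).1; last exact: closed_closure.
have intc : interior (closure (radial_hypograph phi)) = radial_hypograph phi.
  apply/seteqP; split.
    rewrite closure_radial_hypograph//.
    exact: interior_closure_radial_hypograph.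
  by rewrite -open_subsetE//; exact: subset_closure.
have -> : interior (radial_hypograph phi) = radial_hypograph phi.
  by apply/interior_id.
rewrite intc closure_radial_hypograph//.
suff -> : [set p | p.2 != 0 -> enorm p.2 <= phi (p.1, direction p.2)] `\`
  radial_hypograph phi = radial_graph phi by [].
apply/seteqP; split=> [p [/= phip]|p [p0 phip]].
  move/not_implyP => [p0 /negP]; rewrite -leNgt => le; split=> //.
  by apply/eqP; rewrite eq_le phip.
by split; [rewrite /= {1}phip|move=> /(_ p0); rewrite {1}phip ltxx].
Qed.

(** The whole time axis lies in the set, and each point is joined to it by a segment at fixed time;
    the unions of axis and segment all share the origin. *)
Lemma connected_radial_hypograph (R : realType) (n : nat)
    (phi : R * 'rV[R]_n -> R) :
  connected (radial_hypograph phi).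
Proof.
pose axis : set (R * 'rV[R]_n) := (fun t => (t, 0)) @` setT.
pose radius (p : R * 'rV[R]_n) := (fun k => (p.1, k *: p.2)) @` `[0, 1].
have -> : radial_hypograph phi =
    \bigcup_(p in radial_hypograph phi) (axis `|` radius p).
  apply/seteqP; split=> [p phip|q [p phip [[t _ <-]|]]].
  - exists p => //; right; exists 1; last by rewrite scale1r; case: p {phip}.
    by rewrite /= in_itv /= ler01 lexx.
  - by rewrite /radial_hypograph /= eqxx.
  - move=> [k /=]; rewrite in_itv /= => /andP[k0 k1] <-.
    rewrite /radial_hypograph /=.
    rewrite scaler_eq0 negb_or => /andP[kn0 p0].
    have {}k0 : 0 < k by rewrite lt0r kn0.
    rewrite direction_scale// enormZ gtr0_norm//.
    by apply: le_lt_trans (phip p0); rewrite ler_piMl// enorm_ge0.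
apply: bigcup_connected.
  by exists (0, 0) => p _; left; exists 0.
move=> p _; apply: connectedU.
- exists (p.1, 0); split; first by exists p.1.
  by exists 0; rewrite ?scale0r//= in_itv /= lexx ler01.
- apply: connected_continuous_connected.
    by apply/connected_intervalP => x y _ _ z _.
  apply: continuous_subspaceT => t.
  exact: (@cvg_pair _ _ _ (nbhs t) (nbhs t) (nbhs (0 : 'rV[R]_n))
    _ _ _ id (fun=> 0) cvg_id (cvg_cst _)).
- apply: connected_continuous_connected.
    by apply/connected_intervalP; exact: interval_is_interval.
  exact/continuous_subspaceT/scale_snd_continuous.
Qed.

(** * Rotations and local graphs of the boundary *)

(* Flipping the last coordinate turns an orthogonal matrix into a rotation. *)
Lemma orthogonal_to_rotation (R : realType) (m : nat) (H : 'M[R]_m.+1) :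
  H *m H^T = 1%:M ->
  exists (A : 'M[R]_m.+1) (sigma : R),
    [/\ sigma = 1 \/ sigma = -1, rotation A &
     forall p, new_coords A p =
       ((new_coords H p).1, sigma * (new_coords H p).2)].
Proof.
move=> HHT; pose sigma := \det H.
have sigma2 : sigma * sigma = 1.
  by rewrite -{2}[sigma]det_tr -det_mulmx HHT det1.
(* The last diagonal entry is [\det H] itself, so the product has determinant
   [sigma * sigma = 1]. *)
pose d : 'rV[R]_m.+1 := row_snoc (const_mx 1) sigma.
have sigma1 : sigma = 1 \/ sigma = -1.
  have : sigma ^+ 2 == 1 by rewrite expr2 sigma2.
  by rewrite sqrf_eq1 => /orP[]/eqP; [left|right].
exists (H *m diag_mx d), sigma; split => //.
  split.
    rewrite trmx_mul tr_diag_mx mulmxA -(mulmxA H) mulmx_diag.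
    have -> : diag_mx (\row_i (d 0 i * d 0 i)) = 1%:M.
      rewrite -diag_const_mx; congr diag_mx; apply/rowP => j; rewrite !mxE.
      by case: unliftP => [i|] _; rewrite ?mxE ?mulr1.
    by rewrite mulmx1.
  rewrite det_mulmx det_diag (bigD1_ord ord_max)//= row_snoc_max.
  by rewrite big1 ?mulr1// => i _; rewrite row_snoc_lift mxE.
move=> p; rewrite /new_coords mulmxA mul_mx_diag /=; congr (_, _, _).
  apply/rowP => j; rewrite !mxE.
  by rewrite liftK mxE mulr1.
by rewrite [LHS]mxE row_snoc_max mulrC.
Qed.

(** Transports [phi] by [H], whose inverse is [H^T], so that the graph equation becomes the one
    solved by [implicit_lip]. The cutoff [delta / 2] keeps the height [z] away from 0. *)
Lemma radial_graph_local (R : realType) (m : nat)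
    (phi : R * 'rV[R]_m.+1 -> R) (H : 'M[R]_m.+1) (delta K : R) :
  H *m H^T = 1%:M ->
  lip_1_half (setT `*` @unit_sphere R m.+1) phi ->
  0 < delta -> (forall s w, unit_sphere w -> delta < phi (s, w) < K) ->
  exists (eta : R) (psi : R * 'rV[R]_m -> R),
    let B := [set p : R * 'rV[R]_m | enorm p.2 < eta] in
    [/\ 0 < eta, lip_1_half B psi &
     forall p, B (new_coords H p).1 -> delta / 2 < (new_coords H p).2 ->
       radial_graph phi p <-> (new_coords H p).2 = psi (new_coords H p).1].
Proof.
move=> HHT [M [M0 lip]] delta0 bnd.
have HTH : H^T *m H^T^T = 1%:M by rewrite trmxK; apply: mulmx1C.
pose phiH (p : R * 'rV[R]_m.+1) := phi (p.1, p.2 *m H^T).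
have sphH (w : 'rV[R]_m.+1) : unit_sphere w -> unit_sphere (w *m H^T).
  by rewrite /unit_sphere /= enorm_orthogonal.
have lipH p q : unit_sphere p.2 -> unit_sphere q.2 ->
    `|phiH p - phiH q| <= M * (Num.sqrt `|p.1 - q.1| + enorm (p.2 - q.2)).
  move=> /sphH p1 /sphH q1.
  have := lip (p.1, p.2 *m H^T) (q.1, q.2 *m H^T) (conj I p1) (conj I q1).
  by rewrite /= -mulmxBl enorm_orthogonal.
have bndH s w : unit_sphere w -> delta < phiH (s, w) < K.
  by move=> /sphH w1; exact: bnd.
have dK : delta < K.
  by have /andP[] := bndH 0 _ (unit_sphere_last_vector R m); exact: lt_trans.
have posH s w : unit_sphere w -> 0 < phiH (s, w) < K.
  by move=> /bndH - /(_ s) /andP[dp ->]; rewrite (lt_trans delta0 dp).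
have hlip := ray_height_lip M0 lipH posH.
set h := ray_height phiH in hlip.
pose L := 2 * M + K; have L0 : 0 < L by rewrite /L; lra.
(* For [enorm u <= 1] the vector [(u, 1)] has norm at most 2, whence [h > delta / 2]. The two terms
   of [eta] ensure [eta <= c] and [2 * L * eta <= c ^+ 2]. *)
pose c := delta / 2; have c0 : 0 < c by rewrite /c; lra.
pose eta := Num.min c (c ^+ 2 / (2 * L)).
have eta0 : 0 < eta by rewrite lt_min c0 divr_gt0 ?exprn_gt0 ?mulr_gt0.
have hbnd p : enorm p.2 <= 1 -> c < h p < K.
  move=> p1; rewrite /h /ray_height.
  have /andP[dp pK] := bndH p.1 _ (unit_sphere_normalize (row_snoc1_neq0 p.2)).
  set N := enorm _ in dp pK *; have N1 : 1 <= N := enorm_row_snoc1_ge1 _.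
  have N2 : N <= 2.
    rewrite -ler_sqr ?nnegrE ?enorm_ge0// sqr_enorm_row_snoc expr1n.
    by have := exprn_ile1 2 (enorm_ge0 p.2) p1; lra.
  have N0 : 0 < N by lra.
  rewrite ltr_pdivlMr// ltr_pdivrMr//; apply/andP; split.
    by apply: le_lt_trans dp; rewrite /c mulrAC ler_pdivrMr// ler_pM2l.
  by apply: (lt_le_trans pK); rewrite ler_peMr//; lra.
have cK : 0 < c < K by rewrite c0 /c /=; lra.
have etac : 0 < eta <= c by rewrite eta0 ge_min lexx.
have small : 2 * L * eta <= c ^+ 2.
  by rewrite mulrC -ler_pdivlMr ?mulr_gt0// ge_min lexx orbT.
have [psi [psilip psiP]] := implicit_lip L0 cK etac small hlip hbnd.
exists eta, psi; split => // p Bp cz.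
rewrite -(psiP _ _ Bp (ltW cz)) /=.
set y := p.2 *m H in Bp cz *; set u := col' ord_max y; set z := y 0 ord_max.
have z0 : 0 < z by apply: lt_trans cz.
have ye : y = z *: row_snoc (z^-1 *: u) 1.
  by rewrite row_snocZ scalerA divff ?gt_eqF// scale1r mulr1 row_snocP.
have y0 : y != 0 by rewrite ye scaler_eq0 gt_eqF// (negbTE (row_snoc1_neq0 _)).
have yp : p.2 = y *m H^T by rewrite /y -mulmxA HHT mulmx1.
have p0 : p.2 != 0 by rewrite -enorm_gt0 yp enorm_orthogonal// enorm_gt0.
have Nx : enorm p.2 = z * enorm (row_snoc (z^-1 *: u) 1).
  by rewrite yp enorm_orthogonal// {1}ye enormZ gtr0_norm.
have dx : direction p.2 = direction (row_snoc (z^-1 *: u) 1) *m H^T.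
  have <- : direction y = direction (row_snoc (z^-1 *: u) 1).
    by rewrite [in LHS]ye direction_scale.
  by rewrite yp enorm_orthogonal// scalemxAl.
(* Both sides now refer to the ray through [(u / z, 1)]: the graph equation reads [z * N = phi], and
   dividing by [N] gives [z = h]. *)
rewrite /radial_graph /= dx Nx /h /ray_height /phiH /=.
set N := enorm _; have N0 : N != 0 by rewrite enorm_eq0 row_snoc1_neq0.
split=> [[_ <-]|zE]; first by rewrite mulfK.
by split => //; rewrite {1}zE mulfVK.
Qed.

(** * Charts around the boundary points *)

Theorem theorem6 (R : realType) (m : nat) (Omega : set (R * 'rV[R]_m.+1)) :
  noncylindrical_starlike_lip Omega -> lip_domain Omega.
Proof.
move=> [opO [phi [phi0 lip [delta [K [delta0 K0 bnd]]] OE]]].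
rewrite radial_hypographE// in OE.
have [bE bcE] : boundary Omega = radial_graph phi /\
    boundary (closure Omega) = radial_graph phi.
  by rewrite OE; apply: boundary_radial_hypograph => //; rewrite -OE.
split=> //; first by rewrite OE; exact: connected_radial_hypograph.
  by rewrite bE bcE.
move=> X0; rewrite bE => bX0; have [x0 xphi] := bX0.
have w1 := unit_sphere_normalize x0.
have [H [HHT wH]] := householder w1 (unit_sphere_last_vector R m).
have [eta [psi [eta0 psilip psiP]]] := radial_graph_local HHT lip delta0 bnd.
have [A [sigma [sigma1 rotA newA]]] := orthogonal_to_rotation HHT.
(* In the coordinates of [H], the point [X0] lies on the last axis at height [enorm X0.2]. *)
have X0H : X0.2 *m H = row_snoc 0 (enorm X0.2).
  have {1}-> : X0.2 = enorm X0.2 *: direction X0.2.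
    by rewrite scalerA divff ?scale1r// enorm_eq0.
  by rewrite -scalemxAl wH row_snocZ scaler0 mulr1.
have coordX0 : new_coords H X0 = ((X0.1, 0), enorm X0.2).
  rewrite /new_coords X0H row_snoc_max; congr (_, _, _).
  by apply/rowP => j; rewrite mxE row_snoc_lift mxE.
have /andP[dX XK] : delta < enorm X0.2 < K by rewrite xphi; exact: bnd.
pose B := eball (X0.1, 0) eta : set (R * 'rV[R]_m).
(* The ball in [(t, x')] lies in the slab over which [psi] was built. *)
have Beta p : B p -> enorm p.2 < eta.
  rewrite /B /eball /= subr0; apply: le_lt_trans.
  rewrite -[leLHS]ger0_norm ?enorm_ge0// -sqrtr_sqr ler_wsqrtr//.
  by rewrite lerDr sqr_ge0.
have BX0 : B (X0.1, 0).
  by rewrite /B /eball /= !subrr enorm0 expr0n /= addr0 sqrtr0.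
(* The interval is []delta / 2, K[], reflected through 0 when [sigma = -1]. *)
have abP : exists a b : R,
    forall z, (a < sigma * z < b) = (delta / 2 < z < K).
  case: sigma1 => ->.
    by exists (delta / 2), K => z; rewrite mul1r.
  by exists (- K), (- (delta / 2)) => z; rewrite mulN1r !ltrN2 andbC.
have [a [b ab]] := abP.
have sigma_inj : injective ( *%R sigma).
  by apply: mulfI; case: sigma1 => ->; rewrite ?oppr_eq0 oner_eq0.
have sigmaN : `|sigma| = 1 by case: sigma1 => ->; rewrite ?normrN1 ?normr1.
have CE p : (new_coords A @^-1` (B `*` `]a, b[)) p <->
    B (new_coords H p).1 /\ delta / 2 < (new_coords H p).2 < K.
  by rewrite /preimage /mkset newA /setX /mkset /= in_itv /= ab.
(* The last coordinate for [A] is [sigma] times that for [H], so the graph is that of [sigma * psi];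
   the Lipschitz constant is unchanged. *)
have SE p : (new_coords A @^-1` graph_on B (fun q => sigma * psi q)) p <->
    B (new_coords H p).1 /\ (new_coords H p).2 = psi (new_coords H p).1.
  rewrite /preimage /mkset newA /graph_on /mkset /=.
  by split=> -[Bp e]; split=> //; [exact: sigma_inj | rewrite e].
exists A, (X0.1, 0), eta, a, b, (fun p => sigma * psi p).
rewrite -/B; split => //.
- by apply/CE; rewrite coordX0; split=> //=; rewrite XK andbT; lra.
- have [M [M0 Mlip]] := psilip; exists M; split => // p q Bp Bq.
  by rewrite -mulrBr normrM sigmaN mul1r; apply: Mlip; exact: Beta.
- apply/SE; rewrite coordX0; split => //.
  have := psiP X0; rewrite coordX0 /= enorm0; case=> //; first lra.
  by move=> /(_ bX0).
(* In the cylinder the height for [H] exceeds [delta / 2], so [psiP] applies in both directions. *)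
- apply/seteqP.
  split=> p [Cp]; have [Bp /andP[dz _]] := (CE p).1 Cp => gp; split=> //.
    by apply/SE; split=> //; exact: (psiP p (Beta _ Bp) dz).1.
  by have [_ zpsi] := (SE p).1 gp; exact: (psiP p (Beta _ Bp) dz).2.
Qed.
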